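(* There exists a non-adaptive tolerant $L_1$-tester for monotonicity of functions $f\colon[n]^d\to[0,1]$ with query complexity (i) $\tilde{O}\!\left(\frac{1}{(\varepsilon_2-\varepsilon_1)^2}\left(\frac{5d}{\varepsilon_2-\varepsilon_1}\right)^d\right)$, for any $0\leq\varepsilon_1<\varepsilon_2\leq1$; and (ii) $2^{\tilde{O}(\sqrt{d}/(\varepsilon_2-3\varepsilon_1)^2)}$, for any $0\leq 3\varepsilon_1<\varepsilon_2\leq1$.
   Context: $[n]^d$ is ordered coordinatewise; $g\colon[n]^d\to[0,1]$ is monotone if $x\preceq y$ implies $g(x)\leq g(y)$. For $f,g\colon[n]^d\to[0,1]$, $L_1(f,g)=\mathbb{E}_{x}[|f(x)-g(x)|]$ for uniform $x\in[n]^d$, and $L_1(f,\mathcal{M})$ is the infimum of $L_1(f,g)$ over monotone $g\colon[n]^d\to[0,1]$. A tolerant $L_1$-tester for monotonicity, given $0\leq\varepsilon_1<\varepsilon_2\leq1$ and query access to $f$, accepts with probability at least $2/3$ if $L_1(f,\mathcal{M})\leq\varepsilon_1$ and rejects with probability at least $2/3$ if $L_1(f,\mathcal{M})\geq\varepsilon_2$. Non-adaptive means queries do not depend on previous answers. $\tilde{O}$ hides polylogarithmic factors. *)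

(* Defs.v *)
From HB Require Import structures.
From mathcomp Require Import all_boot all_order all_algebra.
From mathcomp Require Import boolp classical_sets reals exp.
Set Implicit Arguments. Unset Strict Implicit. Unset Printing Implicit Defensive.
Import Order.TTheory GRing.Theory Num.Theory.
Local Open Scope ring_scope.
Local Open Scope classical_set_scope.

(* Points of the hypergrid [n]^d : functions from coordinates 'I_d to 'I_n
   ('I_n = {0,...,n-1} plays the role of [n] = {1,...,n}). *)
Definition pt (n d : nat) := {ffun 'I_d -> 'I_n}.

Definition pt_le n d (x y : pt n d) : Prop := forall i : 'I_d, (x i <= y i)%N.

Section Defs.
Variable R : realType.

Definition unit_valued n d (g : pt n d -> R) : Prop :=
  forall x, 0 <= g x <= 1.

Definition monotone_fn n d (g : pt n d -> R) : Prop :=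
  forall x y, pt_le x y -> g x <= g y.

Definition L1dist n d (f g : pt n d -> R) : R :=
  (\sum_(x : pt n d) `|f x - g x|) / (#|{: pt n d}|%:R).

Definition L1dist_mono n d (f : pt n d -> R) : R :=
  inf [set L1dist f g | g in [set g | monotone_fn g /\ unit_valued g]].

(* A non-adaptive randomized algorithm: a finite probability space of seeds
   (S, p); on seed s it queries the points Q s (chosen independently of
   answers) and outputs D s applied to the sequence of answers
   (true = accept). *)
Definition accept_prob n d (S : finType) (p : S -> R) (Q : S -> seq (pt n d))
  (D : S -> seq R -> bool) (f : pt n d -> R) : R :=
  \sum_(s : S) p s * ((D s [seq f x | x <- Q s]) : nat)%:R.

Definition nonadaptive_tolerant_L1_tester n d (e1 e2 : R) (q : nat)
  (S : finType) (p : S -> R) (Q : S -> seq (pt n d)) (D : S -> seq R -> bool)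
  : Prop :=
  [/\ (forall s, 0 <= p s), \sum_(s : S) p s = 1,
      (forall s, (size (Q s) <= q)%N) &
      forall f : pt n d -> R, unit_valued f ->
        (L1dist_mono f <= e1 -> 2 / 3 <= accept_prob p Q D f) /\
        (e2 <= L1dist_mono f -> accept_prob p Q D f <= 1 / 3)].

Definition has_tester n d (e1 e2 : R) (q : nat) : Prop :=
  exists (S : finType) (p : S -> R) (Q : S -> seq (pt n d))
         (D : S -> seq R -> bool),
    nonadaptive_tolerant_L1_tester e1 e2 q p Q D.

End Defs.

(* Main.v *)
Require Import Defs.
From HB Require Import structures.
From mathcomp Require Import all_boot all_order all_algebra.
From mathcomp Require Import boolp classical_sets reals exp.
From mathcomp Require Import sequences ring lra.
Import Order.TTheory GRing.Theory Num.Theory.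
Local Open Scope ring_scope.
Set Implicit Arguments.
Unset Strict Implicit.

(* If the monotone functions have a finite L1-cover of radius proportional to D, then a number
   of uniform samples of order (log of the size of the cover) / D^2 suffices: by Chernoff bounds,
   the empirical distances from f to all members of the cover are simultaneously accurate, and
   they reveal the distance from f to the monotone functions up to D. No factor 3 is lost, so in
   both parts the tester separates e1 from e1 + D.

   (i) Rounding every coordinate down to the start of its block, with at most N blocks per
   coordinate, moves a monotone function by at most d / N in L1. With N = floor (5 d / D) this
   leaves functions of N^d cells, whose values are then discretised.

   (ii) A monotone function on [n]^d has total influence at most sqrt d: along a line its
   variance is at most its covariance with the centred rank, and the ranks of distinct
   coordinates are uncorrelated. Hence its Fourier weight above degree k is at most sqrt d / k,
   in any tensor basis whose first one-dimensional function is constant. Applied to a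
   block-rounded function and to an orthonormal basis of the block-constant functions, this
   leaves (d N)^k coefficients with k of order sqrt d / D^2, which are then discretised. *)

(** * Exponential moments and a Chernoff bound for uniform samples *)

Section Concentration.
Variable R : realType.
Implicit Types (z t : R) (m : nat).

(** Inverting [1 - z <= expR (- z)] gives [expR z <= 1 / (1 - z)], and [(1 - z) (1 + z + 2 z^2) = 1
    + z^2 (1 - 2 z)] is at least 1. *)
Lemma expR_le_quadratic z : z <= 1 / 2 -> expR z <= 1 + z + 2 * z ^+ 2.
Proof.
move=> hz.
have h1 : 0 < 1 - z by lra.
have h2 : 1 - z <= expR (- z) by have := expR_ge1Dx (- z); lra.
have h3 : expR z <= (1 - z)^-1.
  by rewrite -[z in expR z]opprK expRN lef_pV2 // posrE ?expR_gt0.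
apply: (le_trans h3); rewrite -[_^-1]mul1r ler_pdivrMr //.
rewrite [leRHS](_ : _ = 1 + z ^+ 2 * (1 - 2 * z)); last by ring.
by rewrite lerDl mulr_ge0 ?sqr_ge0 //; lra.
Qed.

(** The rate [t / 4] minimises [2 l^2 - l t], the exponent that the quadratic bound yields at rate
    [l]; the minimum is [- t^2 / 8]. *)
Lemma mgf_le {T : finType} (Z : T -> R) t : 0 <= t <= 1 ->
  (forall x, `|Z x| <= 1) -> \sum_x Z x <= 0 ->
  \sum_x expR (t / 4 * (Z x - t)) <= #|T|%:R * expR (- (t ^+ 2 / 8)).
Proof.
move=> /andP[t0 t1] Z1 Z0.
have pt_bound x : expR (t / 4 * Z x) <= 1 + t / 4 * Z x + t ^+ 2 / 8.
  have := Z1 x; rewrite ler_norml => /andP[l1 l2].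
  apply: (le_trans (expR_le_quadratic _)); first by nra.
  rewrite lerD2l exprMn.
  have : Z x ^+ 2 <= 1 by nra.
  by have := sqr_ge0 t; nra.
have mgf : \sum_x expR (t / 4 * Z x) <= #|T|%:R * expR (t ^+ 2 / 8).
  apply: (@le_trans _ _ (\sum_x (1 + t / 4 * Z x + t ^+ 2 / 8))).
    by apply: ler_sum => x _.
  rewrite !big_split /= -mulr_sumr !sumr_const -[(t ^+ 2 / 8) *+ _]mulr_natl.
  apply: (@le_trans _ _ (#|T|%:R * (1 + t ^+ 2 / 8))).
    rewrite mulrDr mulr1 lerD2r gerDl; apply: mulr_ge0_le0 => //; lra.
  by apply: ler_wpM2l => //; apply: expR_ge1Dx.
under eq_bigr => x _ do rewrite mulrBr expRD.
rewrite -mulr_suml.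
apply: le_trans (ler_wpM2r (expR_ge0 _) mgf) _.
by rewrite -mulrA -expRD; apply: ler_wpM2l => //; rewrite ler_expR; nra.
Qed.

(** Markov's inequality for the exponential moment, with probabilities kept as unnormalised counts
    of samples. Independence is the distributivity of product over sum. *)
Lemma hoeffding {T : finType} (Z : T -> R) m t : 0 <= t <= 1 ->
  (forall x, `|Z x| <= 1) -> \sum_x Z x <= 0 ->
  \sum_(s : {ffun 'I_m -> T}) ((m%:R * t <= \sum_i Z (s i))%R : nat)%:R <=
    #|T|%:R ^+ m * expR (- (m%:R * (t ^+ 2 / 8))).
Proof.
move=> tI Z1 Z0; have /andP[t0 t1] := tI.
apply: (@le_trans _ _
    (\sum_(s : {ffun 'I_m -> T}) \prod_i expR (t / 4 * (Z (s i) - t)))).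
  apply: ler_sum => s _; case: (leP (m%:R * t)) => h; last first.
    by rewrite mulr0n; apply: prodr_ge0 => i _; apply: expR_ge0.
  rewrite -expR_sum -mulr_sumr -[leLHS]expR0 ler_expR.
  apply: mulr_ge0; first lra.
  by rewrite sumrB sumr_const card_ord -mulr_natl subr_ge0.
rewrite -(bigA_distr_bigA (fun _ x => expR (t / 4 * (Z x - t)))) prodr_const card_ord.
rewrite -mulrN expRM_natl -exprMn.
by apply: lerXn2r (mgf_le tI Z1 Z0); rewrite nnegrE ?sumr_ge0 ?mulr_ge0 //
  => *; apply: expR_ge0.
Qed.

End Concentration.

(** * L1 distance, sampling estimates and the tester built from a cover *)

Section CoverTester.
Variables (R : realType) (n d : nat).
Hypothesis n_gt0 : (0 < n)%N.
Implicit Types (f g h : pt n d -> R).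

Lemma card_pt_gt0 : 0 < #|{: pt n d}|%:R :> R.
Proof. by rewrite ltr0n card_ffun !card_ord expn_gt0 n_gt0. Qed.

Lemma L1dist_ge0 f g : 0 <= L1dist f g.
Proof. by apply: divr_ge0 => //; apply: sumr_ge0. Qed.

Lemma L1distC f g : L1dist f g = L1dist g f.
Proof. by congr (_ / _); apply: eq_bigr => x _; rewrite distrC. Qed.

Lemma L1dist_triangle f g h : L1dist f h <= L1dist f g + L1dist g h.
Proof.
rewrite /L1dist -mulrDl -big_split ler_wpM2r ?invr_ge0 ?ler0n //.
by apply: ler_sum => x _; apply: ler_distD.
Qed.

Lemma L1dist_mono_le f g : monotone_fn g -> unit_valued g ->
  L1dist_mono f <= L1dist f g.
Proof.
move=> gm gu; apply: ge_inf; last by exists g.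
by exists 0 => _ [h _ <-]; apply: L1dist_ge0.
Qed.

Lemma monotone_fn_cst (c : R) : monotone_fn (fun _ : pt n d => c).
Proof. by move=> x y _. Qed.

Lemma unit_valued0 : unit_valued (fun _ : pt n d => 0 : R).
Proof. by move=> x; rewrite lexx ler01. Qed.

Lemma L1dist_mono_adherent f (c : R) : 0 < c ->
  exists g, [/\ monotone_fn g, unit_valued g & L1dist f g < L1dist_mono f + c].
Proof.
move=> c0.
have hi : has_inf [set L1dist f g | g in [set g | monotone_fn g /\ unit_valued g]]%classic.
  split; last by exists 0 => _ [h _ <-]; apply: L1dist_ge0.
  exists (L1dist f (fun=> 0)), (fun=> 0) => //; split.
    exact: monotone_fn_cst.
  exact: unit_valued0.
by have [_ [g [gm gu] <-] lt] := inf_adherent c0 hi; exists g.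
Qed.

Lemma L1_deviation f g : unit_valued f -> unit_valued g ->
  (forall x, `| `|f x - g x| - L1dist f g| <= 1) /\
  \sum_x (`|f x - g x| - L1dist f g) = 0.
Proof.
move=> fu gu; set c := L1dist f g.
have c01 x : 0 <= `|f x - g x| <= 1.
  by rewrite normr_ge0 ler_norml; have := fu x; have := gu x; lra.
have cV : \sum_x `|f x - g x| = #|{: pt n d}|%:R * c.
  by rewrite /c /L1dist mulrC divfK // gt_eqF ?card_pt_gt0.
have c1 : 0 <= c <= 1.
  rewrite /c L1dist_ge0 /L1dist ler_pdivrMr ?card_pt_gt0 // mul1r.
  apply: le_trans (ler_sum _ (_ : forall x, true -> _ <= 1)) _.
    by move=> x _; case/andP: (c01 x).
  by rewrite sumr_const.
split=> [x|]; first by rewrite ler_norml; have := c01 x; lra.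
by rewrite sumrB cV sumr_const -[c *+ _]mulr_natl subrr.
Qed.

Lemma empirical_L1_upper_tail m (t : R) f g : 0 <= t <= 1 ->
  unit_valued f -> unit_valued g ->
  \sum_(s : {ffun 'I_m -> pt n d})
     ((m%:R * (L1dist f g + t) <= \sum_i `|f (s i) - g (s i)|)%R : nat)%:R <=
    #|{: pt n d}|%:R ^+ m * expR (- (m%:R * (t ^+ 2 / 8))).
Proof.
move=> tI fu gu; have [dev1 dev0] := L1_deviation fu gu.
have le0 : \sum_x (`|f x - g x| - L1dist f g) <= 0 by rewrite dev0.
apply: le_trans (hoeffding m tI dev1 le0).
apply: ler_sum => s _; rewrite sumrB sumr_const card_ord -[L1dist f g *+ m]mulr_natl mulrDr.
by rewrite lerBrDl.
Qed.

Lemma empirical_L1_lower_tail m (t : R) f g : 0 <= t <= 1 ->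
  unit_valued f -> unit_valued g ->
  \sum_(s : {ffun 'I_m -> pt n d})
     ((\sum_i `|f (s i) - g (s i)| <= m%:R * (L1dist f g - t))%R : nat)%:R <=
    #|{: pt n d}|%:R ^+ m * expR (- (m%:R * (t ^+ 2 / 8))).
Proof.
move=> tI fu gu; have [dev1 dev0] := L1_deviation fu gu.
pose Z x := - (`|f x - g x| - L1dist f g).
have Z1 x : `|Z x| <= 1 by rewrite normrN dev1.
have Z0 : \sum_x Z x <= 0 by rewrite sumrN dev0 oppr0.
apply: le_trans (hoeffding m tI Z1 Z0).
apply: ler_sum => s _; rewrite sumrN sumrB sumr_const card_ord -[L1dist f g *+ m]mulr_natl mulrBr.
by rewrite opprB lerBrDr addrC -lerBrDr.
Qed.

(* The centres of a cover need not be monotone: replace each by a monotone function near it. *)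
Lemma proper_cover {J : finType} (h : J -> pt n d -> R) (r : R) :
  (forall g, monotone_fn g -> unit_valued g -> exists j, L1dist g (h j) <= r) ->
  exists h' : J -> pt n d -> R,
    (forall j, monotone_fn (h' j) /\ unit_valued (h' j)) /\
    (forall g, monotone_fn g -> unit_valued g -> exists j, L1dist g (h' j) <= 2 * r).
Proof.
move=> hc.
have ch j : exists g', (monotone_fn g' /\ unit_valued g') /\
    ((exists g, [/\ monotone_fn g, unit_valued g & L1dist g (h j) <= r]) ->
     L1dist g' (h j) <= r).
  have [[g [gm gu gr]]|no] :=
    pselect (exists g, [/\ monotone_fn g, unit_valued g & L1dist g (h j) <= r]).
    by exists g.
  (* A centre far from every monotone function covers none of them, so any monotone function may
     replace it. *)
  exists (fun=> 0); split=> //; split; [exact: monotone_fn_cst|exact: unit_valued0].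
have [h' hh'] := choice ch.
exists h'; split=> [j|g gm gu]; first by case: (hh' j).
have [j gj] := hc g gm gu; exists j.
apply: le_trans (L1dist_triangle g (h j) (h' j)) _.
have [_ hj] := hh' j.
have := hj (ex_intro _ g (And3 gm gu gj)); rewrite L1distC; lra.
Qed.

(* The tester queries [m] uniform points and accepts iff some member of the proper cover has
   small empirical distance to [f]; a union bound controls all members at once. *)
Theorem cover_tester (e1 e2 D : R) {J : finType} (h : J -> pt n d -> R) m :
  0 < D <= 1 -> e1 + D <= e2 ->
  (forall g, monotone_fn g -> unit_valued g -> exists j, L1dist g (h j) <= D / 3) ->
  #|J|%:R * expR (- (m%:R * (D ^+ 2 / 512))) <= 1 / 3 ->
  has_tester n d e1 e2 m.
Proof.
move=> /andP[D0 D1] e12 hc hm.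
have [h' [h'm h'c]] := proper_cover hc.
pose V : R := #|{: pt n d}|%:R ^+ m.
have V0 : 0 < V by apply: exprn_gt0; apply: card_pt_gt0.
(* The sampling error is [t = D / 8]. In the far case every member is at distance at least [e2],
   hence the threshold [e2 - D / 8]. In the near case some member lies within
   [e1 + D / 24 + 2 D / 3], and adding [t] stays below the threshold. *)
pose theta : R := e2 - D / 8.
pose t : R := D / 8.
have tI : 0 <= t <= 1 by rewrite /t; lra.
have tail : expR (- (m%:R * (t ^+ 2 / 8))) = expR (- (m%:R * (D ^+ 2 / 512))) :> R.
  by congr expR; rewrite /t; field.
exists {ffun 'I_m -> pt n d}, (fun=> V^-1), (fun s : {ffun 'I_m -> pt n d} => [seq s i | i <- enum 'I_m]),
  (fun (s : {ffun 'I_m -> pt n d}) v => [exists j, \sum_(i < m) `|nth 0 v i - h' j (s i)| <= m%:R * theta]).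
have cardS : \sum_(s : {ffun 'I_m -> pt n d}) V^-1 = 1.
  by rewrite sumr_const card_ffun card_ord -mulr_natl natrX -/V divff // gt_eqF.
split=> //.
- by move=> s; rewrite invr_ge0 ltW.
- by move=> s; rewrite size_map size_enum_ord.
move=> f fu; rewrite /accept_prob.
have reads s i : nth 0 [seq f x | x <- [seq s i | i <- enum 'I_m]] (i : 'I_m) = f (s i).
  by rewrite -map_comp (nth_map i) ?size_enum_ord // nth_ord_enum.
under eq_bigr => s _ do under eq_existsb => j do under eq_bigr => i _ do rewrite reads.
split=> fd.
  (* Near case: one good member forces acceptance, so a single upper tail is enough. *)
  have c0 : 0 < D / 24 by lra.
  have [g [gm gu gf]] := L1dist_mono_adherent f c0.
  have [j gj] := h'c g gm gu.
  have fj : L1dist f (h' j) + t <= theta.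
    by have := L1dist_triangle f g (h' j); rewrite /t /theta; lra.
  have [_ ju] := h'm j.
  have J1 : (1 : R) <= #|J|%:R by rewrite ler1n; apply/card_gt0P; exists j.
  have := empirical_L1_upper_tail m tI fu ju; rewrite -/V tail => up.
  apply: (@le_trans _ _ (\sum_(s : {ffun 'I_m -> pt n d}) V^-1 *
      (1 - ((m%:R * (L1dist f (h' j) + t) <= \sum_i `|f (s i) - h' j (s i)|)%R : nat)%:R))).
    rewrite -mulr_sumr sumrB mulrBr mulr_sumr; under eq_bigr do rewrite mulr1.
    rewrite cardS mulrC.
    suff : (\sum_(s : {ffun 'I_m -> pt n d})
      ((m%:R * (L1dist f (h' j) + t) <= \sum_i `|f (s i) - h' j (s i)|)%R : nat)%:R) / V
       <= 1 / 3 :> R by lra.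
    rewrite ler_pdivrMr //; apply: le_trans up _.
    rewrite mulrC ler_wpM2r ?(ltW V0) //; apply: le_trans hm.
    by rewrite -[leLHS]mul1r ler_wpM2r ?expR_ge0.
  apply: ler_sum => s _; rewrite ler_wpM2l ?invr_ge0 ?(ltW V0) //.
  case: (leP (m%:R * (L1dist f (h' j) + t))) => lt_s; first by rewrite subrr ler0n.
  rewrite subr0 ler1n lt0b; apply/existsP; exists j.
  by apply: le_trans (ltW lt_s) _; rewrite ler_wpM2l.
(* Far case: acceptance means that some member is underestimated by at least [t]; the union bound
   sums the lower tails. *)
apply: (@le_trans _ _ (\sum_(s : {ffun 'I_m -> pt n d}) V^-1 * \sum_j
    ((\sum_i `|f (s i) - h' j (s i)| <= m%:R * (L1dist f (h' j) - t))%R : nat)%:R)).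
  apply: ler_sum => s _; rewrite ler_wpM2l ?invr_ge0 ?(ltW V0) //.
  case: existsP => [[j le_s]|_]; last by apply: sumr_ge0.
  rewrite (bigD1 j) //= (le_trans le_s) ?lerDl ?sumr_ge0 // ler_wpM2l //.
  have [jm ju] := h'm j.
  by have := L1dist_mono_le f jm ju; rewrite /theta /t; lra.
rewrite -mulr_sumr exchange_big /= mulrC ler_pdivrMr //.
apply: (@le_trans _ _ (\sum_(j : J) V * expR (- (m%:R * (D ^+ 2 / 512))))).
  apply: ler_sum => j _; have [_ ju] := h'm j.
  by have := empirical_L1_lower_tail m tI fu ju; rewrite -/V tail.
rewrite sumr_const -[(V * _) *+ _]mulr_natl mulrCA [leRHS]mulrC. apply: ler_wpM2l hm; exact: ltW.
Qed.

(** The samples bring the exponent down to [- (E + 2)]; the size of the cover uses up [expR E], and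
    [expR (- 2) <= 1 / 3] remains because [expR 2 >= 1 + 2]. *)
Lemma entropy_tester (e1 e2 D E : R) {J : finType} (h : J -> pt n d -> R) :
  0 < D <= 1 -> e1 + D <= e2 ->
  (forall g, monotone_fn g -> unit_valued g -> exists j, L1dist g (h j) <= D / 3) ->
  0 <= E -> #|J|%:R <= expR E ->
  exists q : nat, q%:R <= 512 * (E + 2) / D ^+ 2 + 1 /\ has_tester n d e1 e2 q.
Proof.
move=> DI e12 hc E0 JE; have /andP[D0 D1] := DI.
pose x : R := 512 * (E + 2) / D ^+ 2.
have x0 : 0 <= x by apply: divr_ge0; [lra|exact: sqr_ge0].
exists (Num.truncn x).+1; split.
  by rewrite -natr1 lerD2r truncn_le.
apply: (cover_tester DI e12 hc).
have D2 : 0 < D ^+ 2 by apply: exprn_gt0.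
have h1 : E + 2 <= (Num.truncn x).+1%:R * (D ^+ 2 / 512).
  have := truncnS_gt x; rewrite {1}/x ltr_pdivrMr // => gt_x; lra.
apply: (@le_trans _ _ (expR E * expR (- (E + 2)))).
  by apply: ler_pM; rewrite ?ler0n ?expR_ge0 // ler_expR lerN2.
rewrite -expRD [E + _](_ : _ = - 2); last by ring.
rewrite expRN -[leRHS]mul1r div1r mul1r lef_pV2 ?posrE ?expR_gt0 //.
by have := expR_ge1Dx (2 : R); lra.
Qed.

End CoverTester.

(** * Changing one coordinate, and sums over lines of the grid *)

Definition upd {n d : nat} (x : pt n d) (i : 'I_d) (v : 'I_n) : pt n d :=
  [ffun j => if j == i then v else x j].

Section Update.
Variables (R : realType) (n d : nat).
Implicit Types (x : pt n d) (i : 'I_d) (v : 'I_n).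

Lemma upd_same x i v : upd x i v i = v.
Proof. by rewrite ffunE eqxx. Qed.

Lemma upd_neq x i j v : j != i -> upd x i v j = x j.
Proof. by rewrite ffunE => /negPf->. Qed.

Lemma updK x i v : upd (upd x i v) i (x i) = x.
Proof. by apply/ffunP => j; rewrite !ffunE; case: eqVneq => [->|]. Qed.

(** Exchanging [v] with the [i]-th coordinate of [x] is an involution on the pairs [(x, v)]. *)
Lemma sum_upd_swap i (F : pt n d -> 'I_n -> R) :
  \sum_x \sum_v F x v = \sum_x \sum_v F (upd x i v) (x i).
Proof.
rewrite !pair_bigA /= (reindex_inj (h := fun p => (upd p.1 i p.2, p.1 i))) //=.
by apply: (can_inj (g := fun p => (upd p.1 i p.2, p.1 i))) => -[x v] /=;
  rewrite updK upd_same.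
Qed.

Lemma sum_upd i (G : pt n d -> R) :
  \sum_x \sum_v G (upd x i v) = n%:R * \sum_x G x.
Proof.
rewrite -(sum_upd_swap i (fun x _ => G x)) mulr_sumr.
by apply: eq_bigr => x _; rewrite sumr_const card_ord mulr_natl.
Qed.

End Update.

(** * Rounding monotone functions to blocks *)

Section BlockRounding.
Variable R : realType.

(** The shift cancels all but the last [p] terms, each at most 1. If [n <= p], there are at most [p]
    terms to begin with. *)
Lemma sum_sub_shift_le (U : nat -> R) (n p : nat) :
  (forall k, 0 <= U k <= 1) ->
  \sum_(0 <= k < n) (U k - (if (k < p)%N then 0 else U (k - p)%N)) <= p%:R.
Proof.
move=> U01.
have le_size a b : \sum_(a <= k < b) U k <= (b - a)%:R.
  apply: le_trans (_ : \sum_(a <= k < b) 1 <= _); last by rewrite sumr_const_nat.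
  by apply: ler_sum => k _; case/andP: (U01 k).
case: (leqP n p) => np.
  apply: le_trans (_ : \sum_(0 <= k < n) U k <= _).
    apply: ler_sum => k _; rewrite gerBl; case: ifP => // _.
    by case/andP: (U01 (k - p)%N).
  by apply: le_trans (le_size _ _) _; rewrite ler_nat subn0.
rewrite sumrB [X in _ - X](big_cat_nat (n := p)) ?(ltnW np) //=.
rewrite [X in _ - (X + _)]big_nat_cond [X in _ - (X + _)]big1; last first.
  by move=> k /andP[/andP[_ ->]].
have -> : \sum_(p <= k < n) (if (k < p)%N then 0 else U (k - p)%N) =
    \sum_(0 <= k < n - p) U k.
  rewrite -[X in \sum_(X <= _ < _) _]add0n big_addn; apply: eq_bigr => k _.
  by rewrite ltnNge leq_addl /= addnK.
rewrite add0r.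
rewrite [X in X - _](big_cat_nat (n := (n - p)%N)) ?leq_subr //=. rewrite addrAC subrr add0r.
by apply: le_trans (le_size _ _) _; rewrite subKn // ltnW.
Qed.

Lemma sum_sub_round_le n (p : nat) (r : 'I_n -> 'I_n) (u : 'I_n -> R) :
  (forall x y : 'I_n, (x <= y)%N -> u x <= u y) -> (forall x, 0 <= u x <= 1) ->
  (forall x : 'I_n, (x <= r x + p)%N) ->
  \sum_x (u x - u (r x)) <= p%:R.
Proof.
move=> um u01 rp.
(* The default 1 outside ['I_n] only keeps [U] within [0, 1]; the sums never reach it. *)
pose U k := if insub k is Some x then u x else 1 : R.
have UE (x : 'I_n) : U x = u x by rewrite /U valK.
have U01 k : 0 <= U k <= 1 by rewrite /U; case: insubP => // _; rewrite ler01 lexx.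
apply: le_trans (sum_sub_shift_le n p U01); rewrite big_mkord.
apply: ler_sum => x _; rewrite UE lerD2l lerN2.
case: ltnP => px; first by case/andP: (u01 (r x)).
have xpn : (x - p < n)%N by apply: leq_ltn_trans (leq_subr _ _) _.
by rewrite -[(x - p)%N]/(val (Ordinal xpn)) UE; apply: um; rewrite /= leq_subLR addnC.
Qed.

Lemma L1dist_round_le n d (p : nat) (r : 'I_n -> 'I_n) (g : pt n d -> R) :
  (0 < n)%N -> monotone_fn g -> unit_valued g ->
  (forall x : 'I_n, (r x <= x)%N) -> (forall x : 'I_n, (x <= r x + p)%N) ->
  {homo r : x y / (x <= y)%N} ->
  L1dist g (fun x => g [ffun i => r (x i)]) <= d%:R * (p%:R / n%:R).
Proof.
move=> n0 gm gu rle rp rhomo.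
(* Hybrid argument: [rk k] rounds the first [k] coordinates, and each further coordinate costs at
   most [p / n]. *)
pose rk k (x : pt n d) : pt n d := [ffun i : 'I_d => if (i < k)%N then r (x i) else x i].
have n0' : 0 < n%:R :> R by rewrite ltr0n.
have V0 := card_pt_gt0 R d n0.
rewrite /L1dist ler_pdivrMr //.
(* Rounding down can only lower a monotone function, so the absolute values disappear and the
   differences telescope. *)
have -> : \sum_x `|g x - g [ffun i => r (x i)]| = \sum_x (g (rk 0%N x) - g (rk d x)).
  apply: eq_bigr => x _.
  have -> : rk 0%N x = x by apply/ffunP => i; rewrite ffunE.
  have -> : rk d x = [ffun i => r (x i)] by apply/ffunP => i; rewrite !ffunE ltn_ord.
  by rewrite ger0_norm // subr_ge0; apply: gm => i; rewrite ffunE.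
suff step k : (k <= d)%N ->
    \sum_x (g (rk 0%N x) - g (rk k x)) <= k%:R * (p%:R / n%:R) * #|{: pt n d}|%:R.
  exact: step.
elim: k => [|k IH] kd; first by rewrite big1 ?mul0r // => x _; rewrite subrr.
have {}IH := IH (ltnW kd).
rewrite (eq_bigr (fun x => (g (rk 0%N x) - g (rk k x)) + (g (rk k x) - g (rk k.+1 x))));
  last by move=> x _; rewrite addrA subrK.
rewrite big_split /= -natr1 mulrDl mulrDl mul1r lerD //.
pose i := Ordinal kd.
rewrite mulrAC ler_pdivlMr // mulrC -(sum_upd i (fun x => g (rk k x) - g (rk k.+1 x))).
rewrite mulr_natr -sumr_const; apply: ler_sum => x _.
have upd_rk v : rk k (upd x i v) = upd (rk k x) i v.
  apply/ffunP => j; rewrite !ffunE; case: (eqVneq j i) => [->|//].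
  by rewrite /= ltnn.
have upd_rkS v : rk k.+1 (upd x i v) = upd (rk k x) i (r v).
  apply/ffunP => j; rewrite !ffunE; case: (eqVneq j i) => [->|ji].
    by rewrite /= ltnSn.
  by rewrite ltnS leq_eqVlt -[(j : nat) == k]/(j == i) (negPf ji).
under eq_bigr => v _ do rewrite upd_rk upd_rkS.
apply: (@sum_sub_round_le _ _ r (fun v => g (upd (rk k x) i v))) => // v w vw.
by apply: gm => j; rewrite !ffunE; case: eqP.
Qed.

Lemma block_rounding (n N : nat) : (0 < n)%N -> (0 < N)%N ->
  exists (M : nat) (c : 'I_n -> 'I_M) (r : 'I_n -> 'I_n),
    [/\ (M <= N)%N, forall a, exists x, c x = a,
        forall x y, c x = c y -> r x = r y, {homo r : x y / (x <= y)%N} &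
        forall d (g : pt n d -> R), monotone_fn g -> unit_valued g ->
          L1dist g (fun x => g [ffun i => r (x i)]) <= d%:R / N%:R].
Proof.
move=> n0 N0.
(* Blocks have length [b], so a point moves by at most [p <= n / N]. Dividing [n.-1] keeps the
   number [M] of blocks at most [N]; when [N >= n] the blocks are single points. *)
pose p := (n.-1 %/ N)%N; pose b := p.+1; pose M := (n.-1 %/ b).+1.
have lt_n k : (k <= n.-1)%N -> (k < n)%N by move=> ?; rewrite -(prednK n0) ltnS.
have le_n (x : 'I_n) : (x <= n.-1)%N by rewrite -ltnS prednK.
have cP (x : 'I_n) : (x %/ b < M)%N by rewrite ltnS leq_div2r.
have rP (x : 'I_n) : (x %/ b * b < n)%N.
  by apply: leq_ltn_trans (leq_trunc_div _ _) _.
pose r x := Ordinal (rP x).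
exists M, (fun x => Ordinal (cP x)), r; split.
- by rewrite /M ltn_divLR // mulnC -ltn_divLR.
- move=> a; have aP : (a * b < n)%N.
    by apply: lt_n; rewrite -leq_divRL // -ltnS.
  by exists (Ordinal aP); apply: val_inj; rewrite /= mulnK.
- by move=> x y /(congr1 val) /= xy; apply: val_inj; rewrite /= xy.
- by move=> x y xy /=; rewrite leq_mul2r leq_div2r.
move=> d g gm gu.
apply: le_trans (@L1dist_round_le n d p r g n0 gm gu _ _ _) _ => /=.
- by move=> x; apply: leq_trunc_div.
- move=> x; rewrite {1}(divn_eq x b) leq_add2l -ltnS; exact: ltn_pmod.
- by move=> x y xy /=; rewrite leq_mul2r leq_div2r.
apply: ler_wpM2l => //.
rewrite ler_pdivrMr ?ltr0n // mulrC ler_pdivlMr ?ltr0n // -natrM ler_nat.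
by apply: leq_trans (leq_trunc_div _ _) _; apply: leq_pred.
Qed.

End BlockRounding.

(** * Part (i): the net of block-constant functions with discretised values *)

Section GridTester.
Variable R : realType.
Implicit Types D : R.

(** In dimension 0 there is a single point and every function is monotone, so accepting without a
    query is correct once [e2 > 0]. *)
Lemma has_tester_dim0 n (e1 e2 : R) : (0 < n)%N -> 0 < e2 -> has_tester n 0 e1 e2 0.
Proof.
move=> n0 e20.
exists unit, (fun=> 1), (fun=> [::]), (fun _ _ => true); split=> //.
- by rewrite sumr_const card_unit.
move=> f fu; have accept1 : accept_prob (S := unit) (fun=> 1) (fun=> [::]) (fun _ _ => true) f = 1 :> R.
  rewrite /accept_prob. rewrite (eq_bigr (fun=> 1)) => [|s _]; last by rewrite mulr1.
  by rewrite sumr_const card_unit.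
rewrite accept1; split=> [_|le_f]; first lra.
have fm : monotone_fn f by move=> x y _; rewrite (_ : x = y) //; apply/ffunP => -[].
have := L1dist_mono_le f fm fu; rewrite /L1dist big1 ?mul0r => [|x _]; first lra.
by rewrite subrr normr0.
Qed.

Lemma L1dist_le_sup n d (f g : pt n d -> R) (c : R) : (0 < n)%N ->
  (forall x, `|f x - g x| <= c) -> L1dist f g <= c.
Proof.
move=> n0 fg; rewrite /L1dist ler_pdivrMr ?card_pt_gt0 // mulrC mulr_natl -sumr_const.
exact: ler_sum.
Qed.

Lemma truncn_div_bounds (x : R) (K : nat) : (0 < K)%N -> 0 <= x ->
  (Num.truncn (K%:R * x))%:R / K%:R <= x < (Num.truncn (K%:R * x))%:R / K%:R + K%:R^-1.
Proof.
move=> K0 x0; have K0' : 0 < K%:R :> R by rewrite ltr0n.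
have /truncn_itv/andP[l1 l2] : 0 <= K%:R * x by rewrite mulr_ge0.
rewrite ler_pdivrMr // [x * _]mulrC l1 /= -[X in _ + X]mul1r -mulrDl ltr_pdivlMr //.
by rewrite [x * _]mulrC natr1.
Qed.

(** Since [d / D >= 1], truncation costs at most a fifth: [N >= 5 d / D - 1 >= 4 d / D]. *)
Lemma cells_per_side (d : nat) D : (0 < d)%N -> 0 < D <= 1 ->
  let N := Num.truncn (5 * d%:R / D) in
  [/\ (0 < N)%N, N%:R <= 5 * d%:R / D & d%:R / N%:R <= D / 4].
Proof.
move=> d0 /andP[D0 D1] N.
have d1 : 1 <= d%:R :> R by rewrite ler1n.
have x5 : 5 <= 5 * d%:R / D by rewrite ler_pdivlMr //; nra.
have /truncn_itv/andP[N1 N2] : 0 <= 5 * d%:R / D by lra.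
have N4 : 4 * d%:R / D <= N%:R.
  move: N2; rewrite -/N -natr1 => N2.
  have : 5 * d%:R / D - 1 <= N%:R by lra.
  by apply: le_trans; rewrite -subr_ge0; lra.
have N0 : 0 < N%:R :> R by lra.
split=> //; first by rewrite -(ltr0n R).
by rewrite ler_pdivrMr //; move: N4; rewrite ler_pdivrMr //; lra.
Qed.

(** The radius [D / 3] splits into [D / 4] for rounding points to blocks and [D / 12] for rounding
    values to multiples of [1 / K]. The logarithm of the size of the net is at most
    [N^d ln (K + 1)]. *)
Lemma grid_tester n d (e1 e2 : R) D : (0 < n)%N -> (0 < d)%N ->
  0 < D <= 1 -> e1 + D <= e2 ->
  exists q : nat,
    q%:R <= 512 * ((5 * d%:R / D) ^+ d * ln (14 / D) + 2) / D ^+ 2 + 1 /\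
    has_tester n d e1 e2 q.
Proof.
move=> n0 d0 DI e12; have /andP[D0 D1] := DI.
have [] := cells_per_side d0 DI; set N := Num.truncn _ => N0 NU NL.
have [M [c [r [MN cs cr rm rd]]]] := block_rounding R n0 N0.
(* [s a] is a representative of block [a], at which the rounded function is read off. *)
have [s sP] := choice cs.
pose K := (Num.truncn (12 / D)).+1.
have K0 : 0 < K%:R :> R by rewrite ltr0n.
have K12 : K%:R^-1 <= D / 12.
  rewrite -[D / 12]invrK lef_pV2 ?posrE ?invr_gt0 ?divr_gt0 // invf_div.
  by rewrite ltW // truncnS_gt.
have K14 : K.+1%:R <= 14 / D :> R.
  have : 0 <= 12 / D by apply: divr_ge0 => //; apply: ltW.
  move=> /truncn_itv/andP[l1 _].
  have D1' : 1 <= 1 / D by rewrite ler_pdivlMr // mul1r.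
  by rewrite -natr1 /K -natr1; lra.
pose cell (x : pt n d) : {ffun 'I_d -> 'I_M} := [ffun i => c (x i)].
pose h (j : {ffun {ffun 'I_d -> 'I_M} -> 'I_K.+1}) (x : pt n d) : R := (j (cell x))%:R / K%:R.
pose E : R := (N ^ d)%:R * ln K.+1%:R.
have lnK0 : 0 <= ln K.+1%:R :> R by rewrite ln_ge0 // ler1n.
have E0 : 0 <= E by apply: mulr_ge0.
have cover g : monotone_fn g -> unit_valued g -> exists j, L1dist g (h j) <= D / 3.
  move=> gm gu.
  pose v (a : {ffun 'I_d -> 'I_M}) := g [ffun i => r (s (a i))].
  have v01 a : 0 <= v a <= 1 by apply: gu.
  have trunc_lt a : (Num.truncn (K%:R * v a) < K.+1)%N.
    have /andP[v0 v1] := v01 a.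
    rewrite ltnS -(ler_nat R); apply: le_trans (_ : K%:R * v a <= _).
      by rewrite truncn_le mulr_ge0.
    by rewrite -[leRHS]mulr1 ler_wpM2l.
  exists [ffun a => Ordinal (trunc_lt a)].
  apply: le_trans (L1dist_triangle _ (fun x => g [ffun i => r (x i)]) _) _.
  apply: (@le_trans _ _ (D / 4 + D / 12)); last lra.
  apply: lerD; first by apply: le_trans (rd _ _ gm gu) NL.
  apply: L1dist_le_sup => // x.
  have -> : g [ffun i => r (x i)] = v (cell x).
    by congr g; apply/ffunP => i; rewrite !ffunE; apply: cr; rewrite sP.
  have /andP[v0 _] := v01 (cell x).
  have /andP[l1 l2] := truncn_div_bounds (isT : (0 < K)%N) v0.
  rewrite /h ffunE /=; apply: le_trans K12.
  by rewrite ger0_norm ?subr_ge0 // lerBlDl ltW.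
have card : #|{: {ffun {ffun 'I_d -> 'I_M} -> 'I_K.+1}}|%:R <= expR E.
  rewrite !card_ffun !card_ord.
  rewrite expRM_natl lnK ?posrE ?ltr0n // -natrX ler_nat.
  by rewrite leq_pexp2l // leq_exp2r.
have [q [qU qT]] := entropy_tester n0 DI e12 cover E0 card.
exists q; split=> //; apply: le_trans qU _.
rewrite lerD2r ler_wpM2r ?invr_ge0 ?sqr_ge0 // ler_wpM2l // lerD2r.
apply: ler_pM => //; first by rewrite natrX lerXn2r // nnegrE ?ler0n //; apply: le_trans NU.
by rewrite ler_ln ?posrE ?divr_gt0 // ltr0n.
Qed.

Lemma ln_ge_half (x : R) : 2 <= x -> 1 / 2 <= ln x.
Proof.
move=> x2; have x0 : 0 < x by lra.
rewrite -ler_expR lnK ?posrE //; apply: le_trans (expR_le_quadratic (lexx _)) _; lra.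
Qed.

(** The number of levels enters only through [ln (14 / D)], and [14 / D <= (B + 2)^5]; hence a
    single logarithmic factor. *)
Theorem tester_exponential_in_dim :
  exists (C : R) (k : nat), 0 < C /\
    forall (n d : nat) (e1 e2 : R), (0 < n)%N ->
      0 <= e1 -> e1 < e2 -> e2 <= 1 ->
      let B := (e2 - e1)^-2 * ((5 * d%:R) / (e2 - e1)) ^+ d in
      exists q : nat, q%:R <= C * B * (ln (B + 2)) ^+ k /\
        has_tester n d e1 e2 q.
Proof.
(* With [L = ln (B + 2) >= 1 / 2], the bounds [ln (14 / D) <= 5 L], [2 <= 4 P L] and [1 <= 2 B L]
   give [512 (5 + 4) + 2 = 4610]. *)
exists 4610, 1%N; split=> [//|n d e1 e2 n0 e10 e12 e21].
set D := e2 - e1; set P := _ ^+ d => B.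
have DI : 0 < D <= 1 by rewrite /D; lra.
have /andP[D0 D1] := DI.
have DV : 1 <= D^-1 by rewrite -[D^-1]mul1r ler_pdivlMr // mul1r.
have D2 : 1 <= D ^- 2 by rewrite -exprVn expr_ge1 // (le_trans _ DV).
have [d0|d0] := posnP d.
  exists 0%N; split; last by rewrite d0; apply: has_tester_dim0 => //; lra.
  have B0 : 0 <= B by rewrite /B /P d0 expr0 mulr1; lra.
  by rewrite expr1; apply: mulr_ge0; [apply: mulr_ge0|apply: ln_ge0; lra].
have P1 : 1 <= P.
  rewrite /P exprn_ege1 // ler_pdivlMr // mul1r.
  have : 1 <= d%:R :> R by rewrite ler1n.
  lra.
have e12D : e1 + D <= e2 by rewrite /D; lra.
have [q [qU qT]] := grid_tester n0 d0 DI e12D.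
exists q; split=> //; apply: le_trans qU _; rewrite -/P expr1.
have BP : D ^- 2 <= B by rewrite -[leLHS]mulr1 ler_wpM2l //; lra.
have BV : D^-1 <= B.
  by apply: le_trans BP; rewrite -exprVn expr2 -[leLHS]mulr1 ler_wpM2l //; lra.
have L2 : 1 / 2 <= ln (B + 2) by apply: ln_ge_half; lra.
have L14 : ln (14 / D) <= 5 * ln (B + 2).
  have -> : 5 * ln (B + 2) = ln ((B + 2) ^+ 5) by rewrite lnXn ?mulr_natl //; lra.
  have B2 : 0 <= B + 2 by lra.
  rewrite ler_ln ?posrE ?divr_gt0 ?exprn_gt0 //; last lra.
  rewrite exprSr; apply: ler_pM => //; [by rewrite invr_ge0 ltW| |lra].
  apply: (@le_trans _ _ (2 ^+ 4)); first by rewrite -natrX ler_nat.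
  by rewrite lerXn2r ?nnegrE //; lra.
set L := ln (B + 2) in L2 L14 *.
apply: (@le_trans _ _ (512 * (P * (5 * L) + 4 * (P * L)) / D ^+ 2 + 2 * (B * L))).
  apply: lerD.
    rewrite ler_wpM2r ?invr_ge0 ?sqr_ge0 // ler_wpM2l //.
    by apply: lerD; [apply: ler_wpM2l => //; lra|nra].
  by nra.
by rewrite /B le_eqVlt; apply/orP; left; apply/eqP; rewrite /B; ring.
Qed.

End GridTester.

(** * Total influence of monotone functions *)

Section Influence.
Variables (R : realType) (n d : nat).
Hypothesis n_gt0 : (0 < n)%N.
Implicit Types (a b v : 'I_n) (x : pt n d) (i j : 'I_d).

Definition cmp_sign a b : R := (b < a)%N%:R - (a < b)%N%:R.
(** This is [2 a - (n - 1)], the count of points below [a] minus the count above. *)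
Definition centered_rank a : R := \sum_b cmp_sign a b.

Lemma cmp_signC a b : cmp_sign b a = - cmp_sign a b.
Proof. by rewrite /cmp_sign opprB. Qed.

Lemma sum_centered_rank : \sum_a centered_rank a = 0.
Proof.
have : \sum_a centered_rank a = - \sum_a centered_rank a.
  rewrite [LHS]exchange_big /= -sumrN; apply: eq_bigr => a _.
  by rewrite -sumrN; apply: eq_bigr => b _; rewrite cmp_signC.
lra.
Qed.

Lemma sqr_centered_rank_le a : centered_rank a ^+ 2 <= n%:R ^+ 2.
Proof.
have : `|centered_rank a| <= n%:R.
  apply: le_trans (ler_norm_sum _ _ _) _.
  rewrite -[n in n%:R]card_ord -sumr_const; apply: ler_sum => b _.
  by rewrite /cmp_sign; case: ltngtP => _; rewrite ?subr0 ?sub0r ?normrN ?normr1 ?normr0.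
by move=> le_n; rewrite -real_normK ?num_real // lerXn2r // nnegrE.
Qed.

(** Summing first along direction [i] freezes [x j] and leaves the zero sum of the ranks. *)
Lemma sum_mul_centered_rank i j : i != j ->
  \sum_(x : pt n d) centered_rank (x i) * centered_rank (x j) = 0.
Proof.
move=> ij; apply: (mulfI (x := n%:R)); first by rewrite pnatr_eq0 -lt0n.
rewrite mulr0 -(sum_upd i (fun x : pt n d => centered_rank (x i) * centered_rank (x j))).
rewrite big1 // => x _.
under eq_bigr => v _ do rewrite upd_same upd_neq 1?eq_sym //.
by rewrite -mulr_suml sum_centered_rank mul0r.
Qed.

Lemma sum_sqr_rank_sum :
  \sum_(x : pt n d) (\sum_i centered_rank (x i)) ^+ 2 <= d%:R * n%:R ^+ 2 * #|{: pt n d}|%:R.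
Proof.
under eq_bigr => x _ do rewrite expr2 mulr_suml.
rewrite exchange_big /=.
apply: (@le_trans _ _ (\sum_(i < d) n%:R ^+ 2 * #|{: pt n d}|%:R)); last first.
  by rewrite sumr_const card_ord -[_ *+ d]mulr_natl mulrA.
apply: ler_sum => i _.
under eq_bigr => x _ do rewrite mulr_sumr.
rewrite exchange_big /= (bigD1 i) //= [X in _ + X]big1 ?addr0 => [|j ji].
  rewrite mulr_natr -sumr_const; apply: ler_sum => x _.
  by rewrite -expr2 sqr_centered_rank_le.
by rewrite sum_mul_centered_rank // eq_sym.
Qed.

(* [n * n ^ d] times the expected variance of [h] along a random line in direction [i]. *)
Definition coord_influence (h : pt n d -> R) i : R :=
  n%:R * (\sum_x h x ^+ 2) - \sum_x \sum_v h x * h (upd x i v).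

(** For values in [0, 1] a squared difference is at most its absolute value, which by monotonicity
    is [cmp_sign] times the difference. Summed over each line, both sides become twice the sides
    claimed. *)
Lemma coord_influence_le (h : pt n d -> R) i : monotone_fn h -> unit_valued h ->
  coord_influence h i <= \sum_x h x * centered_rank (x i).
Proof.
move=> hm hu; rewrite /coord_influence.
have sq : \sum_x \sum_v (h x - h (upd x i v)) ^+ 2 =
    2 * (n%:R * (\sum_x h x ^+ 2) - \sum_x \sum_v h x * h (upd x i v)).
  have -> : \sum_x \sum_v (h x - h (upd x i v)) ^+ 2 =
      \sum_x \sum_v (h x ^+ 2 - (h x * h (upd x i v)) *+ 2 + h (upd x i v) ^+ 2).
    by apply: eq_bigr => x _; apply: eq_bigr => v _; rewrite sqrrB.
  under eq_bigr => x _ do rewrite big_split sumrB /=.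
  rewrite big_split sumrB /= (sum_upd i (fun x => h x ^+ 2)).
  under eq_bigr => x _ do rewrite sumr_const card_ord -mulr_natl.
  rewrite -mulr_sumr; under [X in _ - X + _]eq_bigr => x _ do rewrite sumrMnl.
  by rewrite sumrMnl -mulr_natl; ring.
have le_cmp x v : (h x - h (upd x i v)) ^+ 2 <= cmp_sign (x i) v * (h x - h (upd x i v)).
  have := hu x; have := hu (upd x i v); rewrite /cmp_sign.
  case: ltngtP => [vx|xv|/val_inj ->].
  - have : h (upd x i v) <= h x.
      by apply: hm => j; rewrite ffunE; case: eqP => // ->; apply: ltnW.
    by rewrite subr0 mul1r; nra.
  - have : h x <= h (upd x i v).
      by apply: hm => j; rewrite ffunE; case: eqP => // ->; apply: ltnW.
    by rewrite sub0r mulN1r; nra.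
  - by rewrite (_ : upd x i (x i) = x) ?subrr ?mul0r ?expr0n //; apply/ffunP => j;
      rewrite ffunE; case: eqP => // ->.
have swap : \sum_(x : pt n d) \sum_v cmp_sign (x i) v * h (upd x i v) =
    - \sum_x h x * centered_rank (x i).
  rewrite (sum_upd_swap i) -sumrN; apply: eq_bigr => x _.
  rewrite /centered_rank mulr_sumr -sumrN; apply: eq_bigr => v _.
  by rewrite updK upd_same cmp_signC mulNr mulrC.
have : \sum_x \sum_v (h x - h (upd x i v)) ^+ 2 <= 2 * \sum_x h x * centered_rank (x i).
  apply: (@le_trans _ _ (\sum_(x : pt n d) \sum_v cmp_sign (x i) v * (h x - h (upd x i v)))).
    by apply: ler_sum => x _; apply: ler_sum.
  under eq_bigr => x _ do under eq_bigr => v _ do rewrite mulrBr.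
  under eq_bigr => x _ do rewrite sumrB -mulr_suml mulrC -/(centered_rank _).
  by rewrite sumrB swap; lra.
by rewrite sq; lra.
Qed.

(* The ranks of distinct coordinates are uncorrelated, so their sum has standard deviation O(sqrt d). *)
Lemma total_influence_le (h : pt n d -> R) : monotone_fn h -> unit_valued h ->
  \sum_i coord_influence h i <= #|{: pt n d}|%:R * n%:R * Num.sqrt d%:R.
Proof.
move=> hm hu.
have [d0|d0] := posnP d.
  rewrite big1 ?mulr_ge0 ?sqrtr_ge0 // => -[k kd] _; by exfalso; rewrite d0 in kd.
pose r : R := Num.sqrt d%:R.
have r2 : r ^+ 2 = d%:R by rewrite sqr_sqrtr.
have r0 : 0 < r by rewrite sqrtr_gt0 ltr0n.
have n0 : 0 < n%:R :> R by rewrite ltr0n.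
have c0 : 0 < n%:R * r by rewrite mulr_gt0.
set V : R := #|{: pt n d}|%:R.
apply: (@le_trans _ _ (\sum_i \sum_(x : pt n d) h x * centered_rank (x i))).
  by apply: ler_sum => i _; apply: coord_influence_le.
rewrite exchange_big /=.
(* Weighted AM-GM in place of Cauchy-Schwarz: [h P <= P^2 / (2 c) + c / 2], where [c = n sqrt d]
   bounds the root mean square of the rank sum [P]. *)
apply: (@le_trans _ _ (\sum_(x : pt n d) ((\sum_i centered_rank (x i)) ^+ 2 / (2 * (n%:R * r)) + n%:R * r / 2))).
  apply: ler_sum => x _; rewrite -mulr_sumr; set P := \sum_i _.
  have -> : P ^+ 2 / (2 * (n%:R * r)) + n%:R * r / 2 =
      (P ^+ 2 + (n%:R * r) ^+ 2) / (2 * (n%:R * r)).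
    by field; rewrite !gt_eqF.
  rewrite ler_pdivlMr ?mulr_gt0 //; have := hu x.
  set c := n%:R * r in c0 *; set y := h x => /andP[y0 y1].
  have : 0 <= (P - y * c) ^+ 2 by apply: sqr_ge0.
  have : (y * c) ^+ 2 <= c ^+ 2.
    have c0' := ltW c0.
    have yc0 : 0 <= y * c by apply: mulr_ge0.
    by rewrite lerXn2r ?nnegrE // ler_piMl.
  by rewrite sqrrB -mulr_natl; lra.
rewrite big_split /= -mulr_suml sumr_const -[(n%:R * r / 2) *+ _]mulr_natl.
apply: (@le_trans _ _ (d%:R * n%:R ^+ 2 * V / (2 * (n%:R * r)) + V * (n%:R * r / 2))).
  rewrite lerD2r ler_wpM2r //; last exact: sum_sqr_rank_sum.
  by rewrite invr_ge0 mulr_ge0 // ltW.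
rewrite -/r -r2 le_eqVlt; apply/orP; left; apply/eqP.
by field; rewrite !gt_eqF.
Qed.

End Influence.

(** * An orthonormal basis of the block-constant functions in one dimension *)

Section BlockBasis.
Variable R : realType.

Lemma sum_delta {I : finType} (a : I) (F : I -> R) :
  \sum_k (a == k)%:R * F k = F a.
Proof.
rewrite (bigD1 a) //= eqxx mul1r big1 ?addr0 // => k.
by rewrite eq_sym => /negPf->; rewrite mul0r.
Qed.

(* The Householder reflection exchanging [s] with the first basis vector; when [s] already is
   that vector, [v] and the junk value [(1 - s ord0)^-1] both vanish and [U] is the identity. *)
Lemma householder M (s : 'I_M.+1 -> R) : \sum_k s k ^+ 2 = 1 ->
  exists U : 'I_M.+1 -> 'I_M.+1 -> R,
    [/\ forall b, U ord0 b = s b,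
        forall a b, \sum_k U a k * U b k = (a == b)%:R &
        forall a b, \sum_k U k a * U k b = (a == b)%:R].
Proof.
move=> s1; pose v b : R := (ord0 == b)%:R - s b; pose t := (1 - s ord0)^-1.
have v2 : \sum_k v k ^+ 2 = 2 * (1 - s ord0).
  have -> : \sum_k v k ^+ 2 =
      \sum_k ((ord0 == k)%:R * 1 - 2 * ((ord0 == k)%:R * s k) + s k ^+ 2).
    by apply: eq_bigr => k _; rewrite /v; case: eqP => _ /=; rewrite ?mulr1n ?mulr0n; ring.
  rewrite big_split sumrB /= sum_delta -mulr_sumr sum_delta s1; ring.
have vt b : v b * ((1 - s ord0) * t) = v b.
  have [s0|s0] := eqVneq (1 - s ord0) 0; last by rewrite mulfV // mulr1.
  move: v2; rewrite s0 mulr0 => /eqP; rewrite psumr_eq0 => [/allP/(_ b)|k _]; last exact: sqr_ge0.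
  by rewrite mem_index_enum sqrf_eq0 => /(_ isT)/eqP->; rewrite mul0r.
pose U a b : R := (a == b)%:R - v a * v b * t.
have UC a b : U a b = U b a by rewrite /U eq_sym [v a * _]mulrC.
have UU a b : \sum_k U a k * U b k = (a == b)%:R.
  have -> : \sum_k U a k * U b k = \sum_k ((a == k)%:R * (b == k)%:R -
     (a == k)%:R * v k * (v b * t) - (b == k)%:R * v k * (v a * t) +
     v k ^+ 2 * (v a * v b * t ^+ 2)).
    by apply: eq_bigr => k _; rewrite /U; ring.
  rewrite big_split !sumrB /= -!mulr_suml v2 !sum_delta eq_sym.
  rewrite (_ : 2 * (1 - s ord0) * (v a * v b * t ^+ 2) =
    2 * (v a * ((1 - s ord0) * t)) * v b * t); last by ring.
  by rewrite vt; ring.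
exists U; split=> // [b|a b]; last by under eq_bigr do rewrite ![U _ a]UC ![U _ b]UC; apply: UU.
have v0 : v ord0 = 1 - s ord0 by rewrite /v eqxx.
by rewrite /U v0 mulrAC mulrC vt /v subKr.
Qed.

(** The normalised block indicators are rotated by a reflection whose first row [sqrt (w a / n)]
    turns them into a constant function. The last two clauses describe the kernel of averaging over
    a block, which reproduces block-constant functions. *)
Lemma block_basis n M (c : 'I_n -> 'I_M.+1) : (forall a, exists x, c x = a) ->
  exists e : 'I_M.+1 -> 'I_n -> R,
    [/\ forall x, e ord0 x = (Num.sqrt n%:R)^-1,
        forall a b, \sum_x e a x * e b x = (a == b)%:R,
        forall x y, c x != c y -> \sum_a e a x * e a y = 0 &
        forall x, \sum_y \sum_a e a x * e a y = 1].
Proof.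
move=> cs; pose w a : R := #|[pred x | c x == a]|%:R.
have w0 a : 0 < w a.
  by have [x cx] := cs a; rewrite ltr0n; apply/card_gt0P; exists x; rewrite inE cx.
have n0 : 0 < n%:R :> R by have [x _] := cs ord0; rewrite ltr0n (leq_ltn_trans _ (ltn_ord x)).
have sum_c (G : 'I_M.+1 -> R) : \sum_x G (c x) = \sum_a w a * G a.
  rewrite (partition_big c xpredT) //=; apply: eq_bigr => a _.
  rewrite (eq_bigr (fun=> G a)) => [|x /eqP -> //].
  by rewrite sumr_const mulr_natl.
have [|U [U0 Ur Uc]] := @householder M (fun a => Num.sqrt (w a) / Num.sqrt n%:R).
  under eq_bigr => a _ do rewrite expr_div_n !sqr_sqrtr ?(ltW (w0 a)) ?(ltW n0) //.
  by rewrite -(sum_c (fun=> n%:R^-1)) sumr_const card_ord -[_ *+ n]mulr_natl mulfV // gt_eqF.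
have sw0 a : Num.sqrt (w a) != 0 by rewrite gt_eqF // sqrtr_gt0.
have sw2 a : Num.sqrt (w a) * Num.sqrt (w a) = w a by rewrite -expr2 sqr_sqrtr // ltW.
exists (fun a x => U a (c x) / Num.sqrt (w (c x))).
have kernel x y : \sum_a U a (c x) / Num.sqrt (w (c x)) * (U a (c y) / Num.sqrt (w (c y))) =
    (c x == c y)%:R / (Num.sqrt (w (c x)) * Num.sqrt (w (c y))).
  rewrite -Uc mulr_suml; apply: eq_bigr => a _.
  by rewrite mulrACA invfM.
split=> [x|a b|x y /negPf cxy|x].
- by rewrite U0 mulrAC mulfV // mul1r.
- rewrite (sum_c (fun k => U a k / Num.sqrt (w k) * (U b k / Num.sqrt (w k)))) -Ur.
  apply: eq_bigr => k _; rewrite mulrACA -invfM sw2 mulrC divfK // gt_eqF //; exact: w0.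
- by rewrite kernel cxy mul0r.
under eq_bigr => y _ do rewrite kernel.
rewrite (sum_c (fun k => (c x == k)%:R / (Num.sqrt (w (c x)) * Num.sqrt (w k)))).
rewrite (eq_bigr (fun k => (c x == k)%:R * (w k / (Num.sqrt (w (c x)) * Num.sqrt (w k))))).
  by rewrite sum_delta sw2 mulfV // gt_eqF //; exact: w0.
by move=> k _; rewrite mulrCA.
Qed.

End BlockBasis.

(** * Fourier analysis in the tensor basis *)

Section Fourier.
Variables (R : realType) (n d M : nat) (c : 'I_n -> 'I_M.+1) (e : 'I_M.+1 -> 'I_n -> R).
Hypothesis n_gt0 : (0 < n)%N.
Hypothesis e0 : forall x, e ord0 x = (Num.sqrt n%:R)^-1.
Hypothesis e_ortho : forall a b, \sum_x e a x * e b x = (a == b)%:R.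
Hypothesis e_kernel0 : forall x y, c x != c y -> \sum_a e a x * e a y = 0.
Hypothesis e_kernel1 : forall x, \sum_y \sum_a e a x * e a y = 1.

Local Notation idx := {ffun 'I_d -> 'I_M.+1}.
Implicit Types (al be : idx) (x y : pt n d) (i j : 'I_d) (h u : pt n d -> R).

Definition tensor al x : R := \prod_i e (al i) (x i).
(** Inner products use counting measure, so the squared norm of a unit-valued function is bounded by
    the number of points, not by 1. *)
Definition coef h al : R := \sum_x h x * tensor al x.
Definition degree al : nat := #|[pred i | al i != ord0]|.
Definition block_constant h := forall x y, (forall i, c (x i) = c (y i)) -> h x = h y.

Lemma tensor_ortho al be : \sum_x tensor al x * tensor be x = (al == be)%:R.
Proof.
under eq_bigr do rewrite /tensor -big_split /=.
rewrite -(bigA_distr_bigA (fun i v => e (al i) v * e (be i) v)) /=.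
under eq_bigr do rewrite e_ortho.
case: eqVneq => [->|ne]; first by rewrite big1 // => i _; rewrite eqxx.
have [i ne_i] : exists i, al i != be i.
  by apply/existsP; apply: contraNT ne => /existsPn eq_all; apply/eqP/ffunP => i;
    apply/eqP; rewrite -[_ == _]negbK eq_all.
by rewrite (bigD1 i) //= (negPf ne_i) mul0r.
Qed.

Lemma tensor_kernel x y :
  \sum_al tensor al x * tensor al y = \prod_i \sum_a e a (x i) * e a (y i).
Proof.
rewrite bigA_distr_bigA; apply: eq_bigr => al _.
by rewrite /tensor -big_split.
Qed.

(** The kernel factors over the coordinates. It vanishes when [x] and [y] differ in some block;
    otherwise [h y = h x], and the kernel sums to 1. *)
Lemma fourier_expansion h x : block_constant h -> h x = \sum_al coef h al * tensor al x.
Proof.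
move=> hc; under eq_bigr => al _ do rewrite /coef mulr_suml.
rewrite exchange_big /=.
have -> : \sum_y \sum_al h y * tensor al y * tensor al x =
    \sum_(y : pt n d) h x * \prod_i \sum_a e a (x i) * e a (y i).
  apply: eq_bigr => y _; rewrite -tensor_kernel mulr_sumr.
  have [/forallP cxy|/forallPn [i cxy]] := boolP [forall i, c (x i) == c (y i)].
    rewrite (hc x y) => [|i]; last exact/eqP.
    by apply: eq_bigr => al _; rewrite mulrAC mulrA.
  transitivity (h y * \sum_al tensor al x * tensor al y).
    by rewrite mulr_sumr; apply: eq_bigr => al _; rewrite mulrAC mulrA.
  by rewrite -mulr_sumr tensor_kernel (bigD1 i) //= e_kernel0 // mul0r !mulr0.
rewrite -mulr_sumr -(bigA_distr_bigA (fun i w => \sum_a e a (x i) * e a w)) /=.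
by rewrite big1 ?mulr1 // => i _; apply: e_kernel1.
Qed.

Lemma parseval h u : block_constant h -> \sum_al coef h al * coef u al = \sum_x h x * u x.
Proof.
move=> hc; under [RHS]eq_bigr => x _ do rewrite (fourier_expansion x hc) mulr_suml.
rewrite [RHS]exchange_big /=; apply: eq_bigr => al _.
by rewrite [coef u al]/coef mulr_sumr; apply: eq_bigr => x _; rewrite mulrA mulrAC.
Qed.

Lemma sum_sqr_synthesis (b : idx -> R) :
  \sum_x (\sum_al b al * tensor al x) ^+ 2 = \sum_al b al ^+ 2.
Proof.
under eq_bigr => x _ do rewrite expr2 mulr_suml.
rewrite exchange_big /=; apply: eq_bigr => al _.
under eq_bigr => x _ do rewrite mulr_sumr.
rewrite exchange_big /=.
rewrite (eq_bigr (fun be => (al == be)%:R * (b al * b be))) ?sum_delta ?expr2 // => be _.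
by rewrite -tensor_ortho mulr_suml; apply: eq_bigr => x _; ring.
Qed.

Lemma sum_basis a : \sum_v e a v = Num.sqrt n%:R * (a == ord0)%:R.
Proof.
have sn0 : Num.sqrt n%:R != 0 :> R by rewrite gt_eqF // sqrtr_gt0 ltr0n.
rewrite -e_ortho; under [in RHS]eq_bigr do rewrite e0.
by rewrite -mulr_suml mulrCA mulfV // mulr1.
Qed.

Lemma sum_tensor_upd al x i :
  \sum_v tensor al (upd x i v) = n%:R * (al i == ord0)%:R * tensor al x.
Proof.
have sn0 : Num.sqrt n%:R != 0 :> R by rewrite gt_eqF // sqrtr_gt0 ltr0n.
have -> : \sum_v tensor al (upd x i v) =
    (\sum_v e (al i) v) * \prod_(j | j != i) e (al j) (x j).
  rewrite mulr_suml; apply: eq_bigr => v _; rewrite /tensor (bigD1 i) //= upd_same.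
  by congr (_ * _); apply: eq_bigr => j ji; rewrite upd_neq.
rewrite sum_basis /tensor [in RHS](bigD1 i) //=.
case: eqP => [->|_]; last by rewrite !mulr0 !mul0r.
rewrite e0 !mulr1 mulrA; congr (_ * _).
by rewrite -{2}[n%:R]sqr_sqrtr // expr2 mulfK.
Qed.

(** Summation over lines is self-adjoint, and every tensor is an eigenfunction: a non-constant
    factor at [i] is orthogonal to constants and sums to 0. *)
Lemma coef_average h i al :
  coef (fun x => \sum_v h (upd x i v)) al = n%:R * (al i == ord0)%:R * coef h al.
Proof.
rewrite /coef; under eq_bigr => x _ do rewrite mulr_suml.
transitivity (\sum_x \sum_v h x * tensor al (upd x i v)).
  rewrite (sum_upd_swap i); apply: eq_bigr => x _; apply: eq_bigr => v _.
  by rewrite updK.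
rewrite mulr_sumr; apply: eq_bigr => x _.
by rewrite -mulr_sumr sum_tensor_upd mulrCA.
Qed.

Lemma coord_influence_fourier h i : block_constant h ->
  coord_influence h i = n%:R * \sum_(al : idx) (al i != ord0)%:R * coef h al ^+ 2.
Proof.
move=> hc; rewrite /coord_influence.
under [X in _ - X]eq_bigr => x _ do rewrite -mulr_sumr.
rewrite -(parseval (fun x => \sum_v h (upd x i v)) hc).
under [in X in X - _]eq_bigr => x _ do rewrite expr2.
rewrite -(parseval h hc) !mulr_sumr -sumrB; apply: eq_bigr => al _.
by rewrite coef_average; case: eqP => _ /=; ring.
Qed.

Lemma total_influence_fourier h : block_constant h ->
  \sum_i coord_influence h i = n%:R * \sum_al (degree al)%:R * coef h al ^+ 2.
Proof.
move=> hc; under eq_bigr => i _ do rewrite coord_influence_fourier //.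
rewrite -mulr_sumr exchange_big /=; congr (_ * _); apply: eq_bigr => al _.
rewrite -mulr_suml -natr_sum; congr (_%:R * _).
by rewrite /degree -sum1_card [RHS]big_mkcond; apply: eq_bigr => i _; rewrite inE; case: eqP.
Qed.

(** Markov's inequality for the degree, weighted by the squared coefficients, whose first moment is
    the total influence divided by [n]. *)
Lemma spectral_tail_le h (k : nat) : block_constant h -> monotone_fn h -> unit_valued h ->
  k%:R * \sum_(al | (k <= degree al)%N) coef h al ^+ 2 <= #|{: pt n d}|%:R * Num.sqrt d%:R.
Proof.
move=> hc hm hu; have n0 : 0 < n%:R :> R by rewrite ltr0n.
have := total_influence_le n_gt0 hm hu; rewrite total_influence_fourier // mulrAC mulrC.
rewrite ler_pM2r //; apply: le_trans; rewrite mulr_sumr [leRHS](bigID (fun al => (k <= degree al)%N)) /=.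
rewrite -[leLHS]addr0 lerD //; last by apply: sumr_ge0 => al _; rewrite mulr_ge0 ?sqr_ge0.
by apply: ler_sum => al kal; rewrite ler_wpM2r ?sqr_ge0 // ler_nat.
Qed.

Lemma sum_sqr_coef_le h : block_constant h -> unit_valued h ->
  \sum_al coef h al ^+ 2 <= #|{: pt n d}|%:R.
Proof.
move=> hc hu; under eq_bigr do rewrite expr2.
rewrite parseval // -sumr_const; apply: ler_sum => x _.
by have := hu x; nra.
Qed.

Lemma card_low_degree (k : nat) : (0 < d)%N ->
  (#|[pred al | (degree al < k)%N]| <= (d * M.+1) ^ k)%N.
Proof.
move=> d0.
pose F (t : {ffun 'I_k -> 'I_d * 'I_M.+1}) : idx :=
  [ffun i => if [pick l | (t l).1 == i] is Some l then (t l).2 else ord0].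
suff sub : [pred al | (degree al < k)%N] \subset codom F.
  apply: leq_trans (subset_leq_card sub) _; apply: leq_trans (leq_image_card _ _) _.
  by rewrite card_ffun card_prod !card_ord.
apply/fintype.subsetP => al; rewrite inE => dk.
pose supp := enum [pred i | al i != ord0].
pose pos (l : 'I_k) := nth (Ordinal d0) supp l.
apply/codomP; exists [ffun l => (pos l, al (pos l))]; apply/ffunP => i.
rewrite ffunE; case: pickP => [l|none]; first by rewrite ffunE /= => /eqP->.
apply/eqP; apply: contraT => ali.
have i_supp : i \in supp by rewrite mem_enum inE.
have lt_k : (index i supp < k)%N.
  by apply: leq_trans dk; rewrite ltnS /degree cardE -/supp ltnW // index_mem.
by have := none (Ordinal lt_k); rewrite ffunE /= /pos /= nth_index // eqxx.
Qed.

End Fourier.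

(** * A net from discretised low-degree coefficients *)

Section LowDegreeNet.
Variable R : realType.

Lemma L1dist_le_L2 n d (f g : pt n d -> R) (r : R) : (0 < n)%N -> 0 < r ->
  \sum_x (f x - g x) ^+ 2 <= r ^+ 2 * #|{: pt n d}|%:R -> L1dist f g <= r.
Proof.
move=> n0 r0 fg; rewrite /L1dist ler_pdivrMr ?card_pt_gt0 //.
set V : R := #|_|%:R in fg *.
apply: (@le_trans _ _ (\sum_x ((f x - g x) ^+ 2 / (2 * r) + r / 2))).
  apply: ler_sum => x _; rewrite -(real_normK (num_real (f x - g x))).
  set y := `|_|; have -> : y ^+ 2 / (2 * r) + r / 2 = (y ^+ 2 + r ^+ 2) / (2 * r).
    by field; rewrite gt_eqF.
  rewrite ler_pdivlMr ?mulr_gt0 //.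
  by have := sqr_ge0 (y - r); rewrite sqrrB -mulr_natl; lra.
rewrite big_split /= -mulr_suml sumr_const -[(r / 2) *+ _]mulr_natl -/V.
apply: (@le_trans _ _ (r ^+ 2 * V / (2 * r) + V * (r / 2))).
  by rewrite lerD2r ler_wpM2r // invr_ge0 mulr_ge0 // ltW.
by rewrite le_eqVlt; apply/orP; left; apply/eqP; field; rewrite gt_eqF.
Qed.

(** Divided by the root of the number of points, coefficients lie in [-1, 1] and are rounded to step
    [1 / T]. The two error terms are the rounding of at most [(d M.+1)^k] coefficients and the
    spectral tail. *)
Lemma low_degree_net n d M (c : 'I_n -> 'I_M.+1) (k T : nat) (rho : R) :
  (0 < n)%N -> (0 < d)%N -> (0 < k)%N -> (0 < T)%N -> 0 < rho ->
  (forall a, exists x, c x = a) ->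
  ((d * M.+1) ^ k)%:R / T%:R ^+ 2 + Num.sqrt d%:R / k%:R <= rho ^+ 2 ->
  exists (J : finType) (net : J -> pt n d -> R),
    (#|J| <= (2 * T).+1 ^ ((d * M.+1) ^ k))%N /\
    forall h, block_constant c h -> monotone_fn h -> unit_valued h ->
      exists j, L1dist h (net j) <= rho.
Proof.
move=> n0 d0 k0 T0 rho0 cs err.
have [e [e0 eo ek0 ek1]] := block_basis R cs.
pose L := [pred al : {ffun 'I_d -> 'I_M.+1} | (degree al < k)%N].
pose net0 (j : {ffun {ffun 'I_d -> 'I_M.+1} -> 'I_(2 * T).+1}) (x : pt n d) : R :=
  \sum_al (if al \in L then Num.sqrt #|{: pt n d}|%:R * ((j al)%:R / T%:R - 1) else 0)
    * tensor e al x.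
(* Restricting codes to the support [L] makes the exponent in the count the number of low-degree
   indices only. *)
exists {j : {ffun {ffun 'I_d -> 'I_M.+1} -> 'I_(2 * T).+1} | j \in pffun_on ord0 L predT},
  (fun j => net0 (val j)).
split.
  rewrite card_sig (eq_card (B := pffun_on ord0 L predT)) // card_pffun_on card_ord.
  by rewrite leq_pexp2l // card_low_degree.
move=> h hc hm hu.
set V : R := #|{: pt n d}|%:R.
have V0 : 0 < V by apply: card_pt_gt0.
have sV0 : 0 < Num.sqrt V by rewrite sqrtr_gt0.
have sV2 : Num.sqrt V ^+ 2 = V by rewrite sqr_sqrtr // ltW.
pose y al := coef e h al / Num.sqrt V + 1.
have y02 al : 0 <= y al <= 2.
  suff : `|coef e h al / Num.sqrt V| <= 1 by rewrite ler_norml /y; lra.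
  rewrite normrM normfV (gtr0_norm sV0) ler_pdivrMr // mul1r -sqrtr_sqr ler_wsqrtr //.
  apply: le_trans (sum_sqr_coef_le ek0 ek1 hc hu).
  by rewrite (bigD1 al) //= lerDl sumr_ge0 // => be _; apply: sqr_ge0.
have code_lt al : (Num.truncn (T%:R * y al) < (2 * T).+1)%N.
  have /andP[y0 y2] := y02 al.
  rewrite ltnS -(ler_nat R); apply: le_trans (_ : T%:R * y al <= _).
    by rewrite truncn_le mulr_ge0.
  by rewrite natrM mulrC ler_wpM2r.
pose j := [ffun al => if al \in L then Ordinal (code_lt al) else ord0].
have jP : j \in pffun_on ord0 L predT.
  apply/pffun_onP; split=> //; apply/fintype.subsetP => al; rewrite unfold_in ffunE.
  by case: ifP => //; rewrite eqxx.
exists (exist _ j jP); apply: L1dist_le_L2 => //.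
pose b al := coef e h al -
  (if al \in L then Num.sqrt V * ((j al)%:R / T%:R - 1) else 0).
have -> : \sum_x (h x - net0 j x) ^+ 2 = \sum_x (\sum_al b al * tensor e al x) ^+ 2.
  apply: eq_bigr => x _; congr (_ ^+ 2).
  rewrite {1}(fourier_expansion ek0 ek1 x hc) /net0 -sumrB.
  by apply: eq_bigr => al _; rewrite mulrBl.
rewrite (sum_sqr_synthesis eo) (bigID (mem L)) /=.
have low : \sum_(al | al \in L) b al ^+ 2 <= ((d * M.+1) ^ k)%:R / T%:R ^+ 2 * V.
  apply: (@le_trans _ _ (\sum_(al | al \in L) V / T%:R ^+ 2)).
    apply: ler_sum => al alL; rewrite /b alL ffunE alL /=.
    have /andP[y0 _] := y02 al.
    have /andP[l1 l2] := truncn_div_bounds T0 y0.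
    have -> : coef e h al = Num.sqrt V * (y al - 1).
      by rewrite /y addrK mulrC divfK // gt_eqF.
    rewrite -mulrBr exprMn sV2 ler_wpM2l ?(ltW V0) //.
    by rewrite -exprVn lerXn2r ?nnegrE ?invr_ge0 //; lra.
  rewrite sumr_const -[_ *+ #|_|]mulr_natl mulrA mulrAC ler_wpM2r ?(ltW V0) //.
  by rewrite ler_wpM2r ?invr_ge0 ?sqr_ge0 // ler_nat card_low_degree.
have high : \sum_(al | al \notin L) b al ^+ 2 <= Num.sqrt d%:R / k%:R * V.
  rewrite (eq_big (fun al => (k <= degree al)%N) (fun al => coef e h al ^+ 2)).
  - rewrite mulrAC ler_pdivlMr ?ltr0n //.
    by have := spectral_tail_le n0 e0 eo ek0 ek1 k hc hm hu; rewrite -/V; lra.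
  - by move=> al; rewrite inE -leqNgt.
  - by move=> al /negPf alL; rewrite /b alL subr0.
apply: le_trans (lerD low high) _.
by rewrite -mulrDl ler_wpM2r // ltW.
Qed.

End LowDegreeNet.

(** * Part (ii): the tester from low-degree coefficients *)

Section LowDegreeTester.
Variable R : realType.
Implicit Types D : R.

Lemma low_degree_tester n d (k : nat) (e1 e2 : R) D : (0 < n)%N -> (0 < d)%N -> (0 < k)%N ->
  0 < D <= 1 -> e1 + D <= e2 -> Num.sqrt d%:R / k%:R <= D ^+ 2 / 288 ->
  exists q : nat,
    q%:R <= 20000 * (5 * d%:R ^+ 2 / D) ^+ (2 * k) / D ^+ 3 /\
    has_tester n d e1 e2 q.
Proof.
move=> n0 d0 k0 DI e12 dk; have /andP[D0 D1] := DI.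
have [] := cells_per_side d0 DI; set N := Num.truncn _ => N0 NU NL.
have [[|M] [c [r [MN cs cr rm rd]]]] := block_rounding R n0 N0.
  by case: (c (Ordinal n0)).
pose W := ((d * M.+1) ^ k)%N.
have W1 : 1 <= W%:R :> R by rewrite ler1n expn_gt0 muln_gt0 d0.
(* The squared radius [(D / 12)^2] leaves [D^2 / 288] for rounding coefficients; as [17^2 = 289],
   this [T] meets it. *)
pose T := (Num.truncn (17 * W%:R / D)).+1.
have /truncn_itv/andP[TU' TL] : 0 <= 17 * W%:R / D.
  by apply: divr_ge0; [apply: mulr_ge0|apply: ltW].
rewrite -/T in TL.
have TU : T%:R <= 17 * W%:R / D + 1 by rewrite /T -natr1; lra.
have T0 : 0 < T%:R :> R by rewrite ltr0n.
have WD1 : 1 <= W%:R / D by rewrite ler_pdivlMr //; lra.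
have rho0 : 0 < D / 12 by lra.
have errT : W%:R / T%:R ^+ 2 <= D ^+ 2 / 289.
  have lt_T : 17 * W%:R < T%:R * D by rewrite -ltr_pdivrMr.
  rewrite ler_pdivrMr ?exprn_gt0 //.
  have : (17 * W%:R) ^+ 2 <= (T%:R * D) ^+ 2.
    by rewrite lerXn2r ?nnegrE ?mulr_ge0 // ltW.
  rewrite !exprMn; have : W%:R <= W%:R ^+ 2 :> R by rewrite expr2; nra.
  by lra.
have err : W%:R / T%:R ^+ 2 + Num.sqrt d%:R / k%:R <= (D / 12) ^+ 2.
  by have := sqr_ge0 D; rewrite expr_div_n; lra.
have [J [net [cardJ netP]]] := low_degree_net n0 d0 k0 (isT : (0 < T)%N) rho0 cs err.
have cover g : monotone_fn g -> unit_valued g -> exists j, L1dist g (net j) <= D / 3.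
  move=> gm gu; pose h := fun x : pt n d => g [ffun i => r (x i)].
  have hc : block_constant c h.
    move=> x y cxy; congr g; apply/ffunP => i; rewrite !ffunE.
    by apply: cr; rewrite cxy.
  have hm : monotone_fn h.
    by move=> x y xy; apply: gm => i; rewrite !ffunE; apply: rm.
  have hu : unit_valued h by move=> x; apply: gu.
  have [j hj] := netP h hc hm hu; exists j.
  apply: le_trans (L1dist_triangle g h (net j)) _.
  have := rd d g gm gu; rewrite -/h; lra.
(* The crude bound [ln (2 T + 1) <= 2 T] is affordable: only the logarithm of the query count
   matters here. *)
pose E : R := W%:R * (2 * T)%:R.
have E0 : 0 <= E by apply: mulr_ge0.
have card : #|J|%:R <= expR E.
  apply: (@le_trans _ _ ((2 * T).+1%:R ^+ W)); first by rewrite -natrX ler_nat.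
  rewrite expRM_natl lerXn2r ?nnegrE ?ler0n ?expR_ge0 //.
  by rewrite -natr1 addrC expR_ge1Dx.
have [q [qU qT]] := entropy_tester n0 DI e12 cover E0 card.
exists q; split=> //; apply: le_trans qU _.
have DV : 1 <= D^-1 by rewrite -[D^-1]mul1r ler_pdivlMr // mul1r.
have D2 : 1 <= D^-1 ^+ 2 by rewrite exprn_ege1.
have EW : E <= 36 * (W%:R ^+ 2 / D).
  rewrite /E natrM; apply: (@le_trans _ _ (W%:R * (2 * (18 * (W%:R / D))))).
    by rewrite ler_wpM2l // ler_wpM2l //; lra.
  by rewrite le_eqVlt; apply/orP; left; apply/eqP; ring.
have W2 : 1 <= W%:R ^+ 2 / D.
  by rewrite -[leLHS]mulr1; apply: ler_pM => //; rewrite exprn_ege1.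
have WB : W%:R ^+ 2 <= (5 * d%:R ^+ 2 / D) ^+ (2 * k).
  rewrite [(2 * k)%N]mulnC exprM lerXn2r ?nnegrE ?exprn_ge0 //.
    by rewrite divr_ge0 ?mulr_ge0 ?exprn_ge0 // ltW.
  rewrite natrX lerXn2r ?nnegrE //.
    by rewrite divr_ge0 ?mulr_ge0 ?exprn_ge0 // ltW.
  rewrite natrM; apply: (@le_trans _ _ (d%:R * (5 * d%:R / D))).
    by rewrite ler_wpM2l //; apply: le_trans NU; rewrite ler_nat.
  by rewrite le_eqVlt; apply/orP; left; apply/eqP; ring.
(* The constant absorbs [512 (36 + 2) + 1 = 19457]. *)
apply: (@le_trans _ _ (20000 * W%:R ^+ 2 / D ^+ 3)); last first.
  by rewrite ler_wpM2r ?invr_ge0 ?exprn_ge0 ?(ltW D0) // ler_wpM2l.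
have -> : 20000 * W%:R ^+ 2 / D ^+ 3 = 20000 * (W%:R ^+ 2 / D) * D^-1 ^+ 2 by field; rewrite gt_eqF.
rewrite -exprVn; set u := W%:R ^+ 2 / D in EW W2 *; set w := D^-1 ^+ 2 in D2 *.
by nra.
Qed.

Theorem tester_exponential_in_sqrt_dim :
  exists (C : R) (k : nat), 0 < C /\
    forall (n d : nat) (e1 e2 : R), (0 < n)%N ->
      0 <= 3 * e1 -> 3 * e1 < e2 -> e2 <= 1 ->
      let X := Num.sqrt (d%:R) / (e2 - 3 * e1) ^+ 2 in
      exists q : nat, q%:R <= powR 2 (C * X * (ln (X + 2)) ^+ k) /\
        has_tester n d e1 e2 q.
Proof.
(* Since [k <= 289 X], the exponent [13 + 14 k] reached below is at most [4100 X]; [ln 2 >= 1 / 2]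
   doubles this. *)
exists 8200, 1%N; split=> [//|n d e1 e2 n0 e10 e12 e21].
(* This gap is admissible because [e1 + D = e2 - 2 e1 <= e2]. *)
set D := e2 - 3 * e1 => X.
have DI : 0 < D <= 1 by rewrite /D; lra.
have /andP[D0 D1] := DI.
have [d0|d0] := posnP d.
  exists 0%N; split; last by rewrite d0; apply: has_tester_dim0 => //; lra.
  exact: powR_ge0.
have DV : 1 <= D^-1 by rewrite -[D^-1]mul1r ler_pdivlMr // mul1r.
have D2 : 1 <= D ^- 2 by rewrite -exprVn exprn_ege1.
have d1 : 1 <= d%:R :> R by rewrite ler1n.
have sd1 : 1 <= Num.sqrt d%:R :> R by rewrite -[leLHS]sqrtr1 ler_wsqrtr.
have Xsd : Num.sqrt d%:R <= X by rewrite /X -[leLHS]mulr1 ler_wpM2l //; lra.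
have XD : D^-1 <= X.
  apply: (@le_trans _ _ (D ^- 2)); last by rewrite /X -[leLHS]mul1r ler_wpM2r //; lra.
  by rewrite -exprVn expr2 -[leLHS]mulr1 ler_wpM2l //; lra.
(* Every quantity is bounded by a power of [Y >= 3]: [1 / D <= Y], [d <= Y^2], [5 <= Y^2] and
   [20000 <= Y^10]. *)
pose Y := X + 2.
have Y3 : 3 <= Y by rewrite /Y; lra.
have Y0 : 0 < Y by lra.
have YX : X <= Y by rewrite /Y; lra.
pose k := (Num.truncn (288 * X)).+1.
have X0 : 0 <= 288 * X by lra.
have /truncn_itv/andP[kU kL] := X0; rewrite -/k in kL.
have k289 : k%:R <= 289 * X by rewrite /k -natr1; lra.
have dk : Num.sqrt d%:R / k%:R <= D ^+ 2 / 288.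
  rewrite ler_pdivrMr ?ltr0n //.
  have -> : Num.sqrt d%:R = X * D ^+ 2 by rewrite /X divfK // expf_neq0 // gt_eqF.
  by have := sqr_ge0 D; nra.
have e12D : e1 + D <= e2 by rewrite /D; lra.
have [q [qU qT]] := low_degree_tester n0 d0 (isT : (0 < k)%N) DI e12D dk.
exists q; split=> //; apply: le_trans qU _.
have natY (a b : nat) : (a <= 3 ^ b)%N -> a%:R <= Y ^+ b.
  move=> ab; apply: (@le_trans _ _ (3 ^+ b)); first by rewrite -natrX ler_nat.
  by rewrite lerXn2r ?nnegrE // ltW.
have DY : D^-1 <= Y by lra.
have D0' : 0 <= D^-1 by lra.
have dY : d%:R <= Y ^+ 2.
  rewrite -[leLHS]sqr_sqrtr ?ler0n // lerXn2r ?nnegrE ?sqrtr_ge0 ?(ltW Y0) //; lra.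
have baseY : 5 * d%:R ^+ 2 / D <= Y ^+ 7.
  rewrite (_ : 7 = 2 + 2 * 2 + 1)%N // !exprD exprM expr1.
  apply: ler_pM => //; first by rewrite mulr_ge0 // exprn_ge0.
  apply: ler_pM => //; [exact: exprn_ge0|exact: natY|].
  by rewrite lerXn2r ?nnegrE ?exprn_ge0 // ltW.
have base0 : 0 <= 5 * d%:R ^+ 2 / D by rewrite mulr_ge0 // mulr_ge0 // exprn_ge0.
have qY : 20000 * (5 * d%:R ^+ 2 / D) ^+ (2 * k) / D ^+ 3 <= Y ^+ (10 + 7 * (2 * k) + 3).
  rewrite !exprD [Y ^+ (7 * _)]exprM; apply: ler_pM.
  - by rewrite mulr_ge0 // exprn_ge0.
  - by rewrite invr_ge0 exprn_ge0 // ltW.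
  - apply: ler_pM => //; [exact: exprn_ge0|exact: natY|].
    by rewrite lerXn2r ?nnegrE ?exprn_ge0 // ltW.
  - by rewrite -exprVn lerXn2r ?nnegrE // ltW.
apply: le_trans qY _.
rewrite expr1 /powR gt_eqF // -/Y -[in leLHS](lnK (_ : Y \is Num.pos)) ?posrE //.
rewrite -expRM_natl ler_expR.
have L0 : 0 <= ln Y by apply: ln_ge0; lra.
have ln2 : 1 / 2 <= ln 2 :> R by apply: ln_ge_half.
apply: (@le_trans _ _ (4100 * X * ln Y)).
  rewrite ler_wpM2r // !natrD !natrM; lra.
have XL0 : 0 <= X * ln Y by apply: mulr_ge0; lra.
by nra.
Qed.

End LowDegreeTester.

Unset Implicit Arguments.

Theorem theorem1p9 (R : realType) :
  (* (i): q = O~( (1/delta^2) (5d/delta)^d ), delta = e2 - e1 *)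
  (exists (C : R) (k : nat), 0 < C /\
    forall (n d : nat) (e1 e2 : R), (0 < n)%N ->
      0 <= e1 -> e1 < e2 -> e2 <= 1 ->
      let B := (e2 - e1)^-2 * ((5 * d%:R) / (e2 - e1)) ^+ d in
      exists q : nat, q%:R <= C * B * (ln (B + 2)) ^+ k /\
        has_tester n d e1 e2 q) /\
  (* (ii): q = 2^{O~( sqrt d / (e2 - 3 e1)^2 )} *)
  (exists (C : R) (k : nat), 0 < C /\
    forall (n d : nat) (e1 e2 : R), (0 < n)%N ->
      0 <= 3 * e1 -> 3 * e1 < e2 -> e2 <= 1 ->
      let X := Num.sqrt (d%:R) / (e2 - 3 * e1) ^+ 2 in
      exists q : nat, q%:R <= powR 2 (C * X * (ln (X + 2)) ^+ k) /\
        has_tester n d e1 e2 q).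
Proof.
split; [exact: tester_exponential_in_dim|exact: tester_exponential_in_sqrt_dim].
Qed.
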